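(* Consider SGD on a $G$-smooth function $\mathcal L$ with gradient clipping of bound $C$ and learning rate $\gamma$, and apply random sparsification with sparsification rate $r$, i.e. $w_{t+1}=w_t-\gamma\hat g_t$. Choose symmetric distributions $\tilde p_t$, i.e. $\tilde p_t(\xi_t)=\tilde p_t(-\xi_t)$ for all $\xi_t\in\mathbb R^d$, with $P_{\xi_t\sim\tilde p_t}(\|\xi_t\|<3C/4)\ge\sqrt{1-r}$, and consider $T$ iterations. Then there exists $\kappa\in(1-r,1)$ such that $$\frac1T\sum_{t=1}^T P_{\xi_t\sim\tilde p_t}\big(\|\xi_t\|<3C/4\big)\,h(\nabla w_t)\,\|\nabla w_t\|\;\le\;\frac1\kappa\Big(\frac{\Delta_{\mathcal L}}{\gamma T}+\gamma\frac{GC^2}{2}-\frac1T\sum_{t=1}^T\mathbb E_m[b_t']\Big),$$ where $\Delta_{\mathcal L}:=\mathbb E[\mathcal L(w_1)]-\min_w\mathcal L(w)$.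
   Context: $\|\cdot\|$ is the Euclidean norm and $\odot$ the entrywise product. The objective is $\mathcal L(w)=\mathbb E_{x\in\mathcal X}[\ell(w;x)]$ with $w\in\mathbb R^d$, where $x$ is a training example sampled from the dataset $\mathcal X$; $G$-smooth means that $\nabla\mathcal L$ is $G$-Lipschitz. At step $t$, $g_{t,i}:=\nabla\ell(w_t;x_i)$ is the gradient for example $x_i$ and $\nabla w_t:=\mathbb E_{x\in\mathcal X}[g_{t,i}]$ is the true gradient. The gradient deviation $g_{t,i}-\nabla w_t$ is assumed to be sampled from a zero-mean random variable $\xi_t$, whose true distribution is $p_t$; $\tilde p_t$ is a symmetric proxy for $p_t$. Random sparsification with rate $r$: $m\in\{0,1\}^d$ is a random mask in which $rd$ uniformly drawn positions are set to $0$ and the others to $1$, so $\|m\|_1=(1-r)d$; $m$ and $\xi_t$ are independent. $\mathbb E_m$ is the expectation over the mask. (With no sparsification, $r=0$, $\kappa$ takes the value $1$.) With $g_{t,i}':=m\odot g_{t,i}$, the average over a batch of $B$ examples of the sparsified and clipped gradients is $\hat g_t:=\frac1B\sum_i g_{t,i}'\cdot\min(1,C/\|g_{t,i}'\|)$. $h(v):=\min(\|v\|,C/4)$. Bias term: $\nabla w_t':=m\odot\nabla w_t$ and $\xi_t':=m\odot\xi_t$, with $p_t'$ and $\tilde p_t'$ the distributions of $\xi_t'$ obtained by projecting $p_t$ and $\tilde p_t$ through $m$; then $b_t':=\mathbb E_{\xi_t'\sim p_t'}[\langle\nabla w_t',\hat g_t\rangle]-\mathbb E_{\xi_t'\sim\tilde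 p_t'}[\langle\nabla w_t',\hat g_t\rangle]$, where in each expectation the sparsified per-example gradients are $g_{t,i}'=\nabla w_t'+\xi_t'$ with $\xi_t'$ drawn from the indicated distribution. *)

(* Defs.v *)
From HB Require Import structures.
From mathcomp Require Import all_boot all_order all_algebra.
From mathcomp Require Import all_classical all_reals all_analysis.

Set Implicit Arguments.
Unset Strict Implicit.
Unset Printing Implicit Defensive.

Import Order.TTheory GRing.Theory Num.Theory.
Import numFieldNormedType.Exports.

Local Open Scope classical_set_scope.
Local Open Scope ring_scope.

(* Matrices carry the Borel sigma-algebra of their topology. *)
HB.instance Definition _ (R : realType) (m n : nat) :=
  Measurable.copy 'M[R]_(m, n) (g_sigma_algebraType (@open 'M[R]_(m, n))).

Section Vectors.
Context {R : realType} {d : nat}.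
Implicit Types (u v w m : 'rV[R]_d) (S : {set 'I_d}).

Definition dot u v : R := \sum_(j < d) u ord0 j * v ord0 j.

(* The library norm `|u| on row vectors is the sup norm. *)
Definition enorm u : R := Num.sqrt (dot u u).

Definition hadamard u v : 'rV[R]_d := \row_j (u ord0 j * v ord0 j).

Definition gradient (f : 'rV[R]_d -> R) w : 'rV[R]_d :=
  \row_j 'D_(delta_mx ord0 j) f w.

Definition smooth (G : R) (f : 'rV[R]_d -> R) : Prop :=
  (forall w, differentiable f w) /\
  (forall u v, enorm (gradient f u - gradient f v) <= G * enorm (u - v)).

(* A mask is encoded by the set S of the positions that are set to 0. *)
Definition mask S : 'rV[R]_d := \row_j (j \notin S)%:R.

Definition mask_mean (k : nat) (f : 'rV[R]_d -> R) : R :=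
  (\sum_(S : {set 'I_d} | #|S| == k) f (mask S)) / 'C(d, k)%:R.

(* At v = 0 the quotient C / 0 is 0, and clip C 0 is 0 as it should be. *)
Definition clip (C : R) v : 'rV[R]_d := Num.min 1 (C / enorm v) *: v.

(* [gs] lists the gradients of the batch, already sparsified. *)
Definition ghat (C : R) (B : nat) (gs : B.-tuple 'rV[R]_d) : 'rV[R]_d :=
  B%:R^-1 *: \sum_(g <- gs) clip C g.

Definition hfun (C : R) v : R := Num.min (enorm v) (C / 4%:R).

(* The expectation of f (xi_1, ..., xi_n) for n independent draws xi_i from mu,
   written as an iterated integral. *)
Fixpoint iid_mean (mu : {measure set 'rV[R]_d -> \bar R}) (n : nat) :
    (n.-tuple 'rV[R]_d -> R) -> R :=
  match n return (n.-tuple 'rV[R]_d -> R) -> R with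
  | 0 => fun f => f [tuple]
  | n'.+1 => fun f =>
      \int[mu]_xi iid_mean mu (fun s : n'.-tuple _ => f [tuple of xi :: s])
  end.

Lemma continuous_hadamard u : continuous (hadamard u).
Proof.
move=> v A [P nbhsP sPA].
exists (fun i j => ( *%R (u ord0 j)) @^-1` P i j) => [i j|N PN].
  rewrite [i]ord1; have := nbhsP ord0 j; rewrite mxE.
  exact: (@mulrl_continuous _ (u ord0 j) (v ord0 j)).
by apply: sPA => i j; rewrite mxE; have := PN i j; rewrite [i]ord1.
Qed.

Lemma measurable_hadamard u : measurable_fun setT (hadamard u).
Proof.
apply: (@measurability _ _ _ _ setT (hadamard u) (@open 'rV[R]_d)) => //.
move=> _ [A oA <-]; rewrite setTI; apply: sub_sigma_algebra.
by have /continuousP := @continuous_hadamard u; apply.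
Qed.

(* The projection of the law mu through a mask m. *)
Definition masked_law (mu : {measure set 'rV[R]_d -> \bar R}) m :
    set 'rV[R]_d -> \bar R :=
  pushforward mu (hadamard m).

HB.instance Definition _ mu m := Measure.copy (masked_law mu m)
  (measure_function_pushforward__canonical__measure_function_Measure
     mu (measurable_hadamard m)).

Definition symmetric_law (mu : {measure set 'rV[R]_d -> \bar R}) : Prop :=
  forall A : set 'rV[R]_d, measurable A ->
    mu ((fun xi => - xi) @^-1` A) = mu A.

Definition prob_small (C : R) (mu : {measure set 'rV[R]_d -> \bar R}) : R :=
  fine (mu [set xi : 'rV[R]_d | enorm xi < 3%:R * C / 4%:R]).

End Vectors.

Section Training.
Context {R : realType} {d : nat} {X : finType}.
Variable loss : 'rV[R]_d -> X -> R.
Implicit Types (w m : 'rV[R]_d).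

(* The finite type X indexes the examples of the dataset. *)
Definition objective w : R := #|X|%:R^-1 * \sum_(x : X) loss w x.

Definition example_grad w (x : X) : 'rV[R]_d := gradient (loss ^~ x) w.

Definition true_grad w : 'rV[R]_d :=
  #|X|%:R^-1 *: \sum_(x : X) example_grad w x.

(* The law of the gradient deviation at w for a uniformly drawn example: the
   average of the Dirac masses at the deviations. *)
Definition deviation_law w : {measure set 'rV[R]_d -> \bar R} :=
  mscale (#|X|%:R^-1)%:nng
    (msum (fun i => \d_(nth 0 [seq example_grad w x - true_grad w | x : X] i))
       #|X|).

(* E[<m.grad, ghat>] when the sparsified deviations in the batch are drawn from
   the image of mu under the mask m. *)
Definition masked_alignment (C : R) (B : nat) m w
    (mu : {measure set 'rV[R]_d -> \bar R}) : R :=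
  let v := hadamard m (true_grad w) in
  iid_mean (masked_law mu m) (fun xis : B.-tuple 'rV[R]_d =>
    dot v (ghat C (map_tuple (fun xi => v + xi) xis))).

Definition bias (C : R) (B : nat) (mu : {measure set 'rV[R]_d -> \bar R}) m w : R :=
  masked_alignment C B m w (deviation_law w) - masked_alignment C B m w mu.

End Training.

(* Given the iterate w, the zeroed positions S are uniform among the k-subsets
   of the coordinates, the example x is uniform in the dataset, and S and x are
   independent. *)
Definition fresh_draw {R : realType} {disp : measure_display}
    {Omega : measurableType disp} (P : probability Omega R) {d : nat}
    {X : finType} (k : nat) (w : Omega -> 'rV[R]_d) (S : Omega -> {set 'I_d})
    (x : Omega -> X) : Prop :=
  [/\ forall S0, measurable (S @^-1` [set S0]),
      forall x0, measurable (x @^-1` [set x0]) &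
      forall (A : set 'rV[R]_d) (S0 : {set 'I_d}) (x0 : X), measurable A ->
        P (w @^-1` A `&` S @^-1` [set S0] `&` x @^-1` [set x0]) =
        (P (w @^-1` A) *
          ((#|S0| == k)%:R / 'C(d, k)%:R)%:E * (#|X|%:R^-1)%:E)%E].

(* One step w' = w - gamma * ghat on the batch xs, with zeroed positions S. *)
Definition sgd_step {R : realType} {d : nat} {X : finType}
    (loss : 'rV[R]_d -> X -> R) (C gamma : R) (B : nat) (S : {set 'I_d})
    (xs : B.-tuple X) (w : 'rV[R]_d) : 'rV[R]_d :=
  w - gamma *: ghat C
    (map_tuple (fun x => hadamard (mask S) (example_grad loss w x)) xs).

(* Main.v *)
(* Clipping is the projection onto a ball, hence a monotone map.  Pairing a symmetric
   deviation [xi] with [- xi], this gives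
   [E <v, clip (v + xi)> >= P(|xi| < 3C/4) h(v) |v|].  Applied to [v = m.grad] and averaged
   over the masks, where [E_m |m.grad|^2 = (1 - r) |grad|^2], it bounds the expected
   alignment of the gradient and the step from below, with factor [1 - r], up to the bias.
   Summing the descent lemma over the iterations yields the inequality with [kappa = 1 - r].

   To get [kappa > 1 - r] one needs a strict surplus.  If [G = 0] the gradient vanishes, as
   the objective is bounded below.  If [G > 0] and [r > 0] the last step leaves a surplus
   [r G gamma^2 C^2 / 4]: the gap to the minimum is at least [|grad|^2 / (2 G)] whereas the
   step only sees the masked gradient, so it cannot exploit the whole gap for all masks. *)

Require Import Defs.
From HB Require Import structures.
From mathcomp Require Import all_boot all_order all_algebra.
From mathcomp Require Import all_classical all_reals all_analysis.
From mathcomp Require Import measurable_realfun ring lra.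

Set Implicit Arguments.
Unset Strict Implicit.
Unset Printing Implicit Defensive.

Import Order.TTheory GRing.Theory Num.Theory.
Import numFieldNormedType.Exports.

Local Open Scope classical_set_scope.
Local Open Scope ring_scope.


(** * Euclidean geometry of row vectors *)

Section EuclideanGeometry.
Context {R : realType} {d : nat}.
Implicit Types (u v w m xi : 'rV[R]_d) (S : {set 'I_d}).

Lemma dotC u v : dot u v = dot v u.
Proof. by apply: eq_bigr => j _; rewrite mulrC. Qed.

Lemma dotDl u v w : dot (u + v) w = dot u w + dot v w.
Proof. by rewrite /dot -big_split; apply: eq_bigr => j _; rewrite mxE mulrDl. Qed.

Lemma dotZl a u v : dot (a *: u) v = a * dot u v.
Proof. by rewrite /dot mulr_sumr; apply: eq_bigr => j _; rewrite mxE mulrA. Qed.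

Lemma dotDr u v w : dot u (v + w) = dot u v + dot u w.
Proof. by rewrite dotC dotDl !(dotC _ u). Qed.

Lemma dotZr a u v : dot u (a *: v) = a * dot u v.
Proof. by rewrite dotC dotZl dotC. Qed.

Lemma dotNl u v : dot (- u) v = - dot u v.
Proof. by rewrite -scaleN1r dotZl mulN1r. Qed.

Lemma dotNr u v : dot u (- v) = - dot u v.
Proof. by rewrite dotC dotNl dotC. Qed.

Lemma dot0l u : dot 0 u = 0.
Proof. by rewrite -(scale0r 0) dotZl mul0r. Qed.

Lemma dot_sumr I (s : seq I) u (F : I -> 'rV[R]_d) :
  dot u (\sum_(i <- s) F i) = \sum_(i <- s) dot u (F i).
Proof.
elim/big_rec2: _ => [|i y z _ <-]; last by rewrite dotDr.
by rewrite dotC dot0l.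
Qed.

Lemma dot_ge0 u : 0 <= dot u u.
Proof. by apply: sumr_ge0 => j _; rewrite -expr2 sqr_ge0. Qed.

Lemma enorm_ge0 u : 0 <= enorm u.
Proof. exact: sqrtr_ge0. Qed.

Lemma sqr_enorm u : enorm u ^+ 2 = dot u u.
Proof. by rewrite sqr_sqrtr ?dot_ge0. Qed.

Lemma enorm_eq0 u : enorm u = 0 -> u = 0.
Proof.
move=> u0; have : dot u u = 0 by rewrite -sqr_enorm u0 expr0n.
move/eqP; rewrite /dot psumr_eq0; last by move=> j _; rewrite -expr2 sqr_ge0.
move=> /allP u00; apply/rowP => j; rewrite mxE.
by have /= := u00 j (mem_index_enum _); rewrite mulf_eq0 orbb => /eqP.
Qed.

Lemma enorm0 : enorm (0 : 'rV[R]_d) = 0.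
Proof. by rewrite /enorm dot0l sqrtr0. Qed.

Lemma enormZ a u : enorm (a *: u) = `|a| * enorm u.
Proof. by rewrite /enorm dotZl dotZr mulrA -expr2 sqrtrM ?sqr_ge0// sqrtr_sqr. Qed.

Lemma enormN u : enorm (- u) = enorm u.
Proof. by rewrite -scaleN1r enormZ normrN normr1 mul1r. Qed.

Lemma dot_le_enorm u v : dot u v <= enorm u * enorm v.
Proof.
have [u0|] := ltP 0 (enorm u); last first.
  move=> u0; have/enorm_eq0 -> : enorm u = 0 by apply/eqP; rewrite eq_le u0 enorm_ge0.
  by rewrite dot0l enorm0 mul0r.
have [v0|] := ltP 0 (enorm v); last first.
  move=> v0; have/enorm_eq0 -> : enorm v = 0 by apply/eqP; rewrite eq_le v0 enorm_ge0.
  by rewrite dotC dot0l enorm0 mulr0.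
(* Expanding this square gives [2 |u| |v| (|u| |v| - <u, v>) >= 0], and the factor [2 |u| |v|] is
   positive here. *)
have := dot_ge0 (enorm v *: u - enorm u *: v).
rewrite !(dotDl, dotDr, dotNl, dotNr, dotZl, dotZr) (dotC v u) -!sqr_enorm.
have uv0 := mulr_gt0 u0 v0; move=> h.
rewrite -subr_ge0 -(pmulr_rge0 _ (mulr_gt0 (ltr0Sn R 1) uv0)).
by apply: le_trans h _; rewrite le_eqVlt; apply/orP; left; apply/eqP; ring.
Qed.

Lemma normr_dot_le u v : `|dot u v| <= enorm u * enorm v.
Proof. by rewrite ler_norml dot_le_enorm lerNl -dotNl (le_trans (dot_le_enorm _ _))// enormN. Qed.

Lemma enormD u v : enorm (u + v) <= enorm u + enorm v.
Proof.
rewrite -(ler_pXn2r (n := 2)) ?nnegrE ?addr_ge0 ?enorm_ge0// sqr_enorm.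
rewrite !(dotDl, dotDr) (dotC v u) -!sqr_enorm.
have := dot_le_enorm u v; nra.
Qed.

Lemma hadamardDr m u v : hadamard m (u + v) = hadamard m u + hadamard m v.
Proof. by apply/rowP => j; rewrite !mxE mulrDr. Qed.

Lemma hadamardNr m u : hadamard m (- u) = - hadamard m u.
Proof. by apply/rowP => j; rewrite !mxE mulrN. Qed.

Lemma hadamardZr m a u : hadamard m (a *: u) = a *: hadamard m u.
Proof. by apply/rowP => j; rewrite !mxE mulrCA. Qed.

Lemma dot_hadamard m u v : dot u (hadamard m v) = dot (hadamard m u) v.
Proof. by apply: eq_bigr => j _; rewrite !mxE mulrA [u _ _ * _]mulrC. Qed.

Lemma mask_idem S u : hadamard (Defs.mask S) (hadamard (Defs.mask S) u) = hadamard (Defs.mask S) u.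
Proof. by apply/rowP => j; rewrite !mxE; case: (j \in S); rewrite ?mul0r ?mul1r. Qed.

Lemma enorm_mask_le S u : enorm (hadamard (Defs.mask S) u) <= enorm u.
Proof.
rewrite ler_wsqrtr// ler_sum// => j _; rewrite !mxE.
by case: (j \in S); rewrite ?mul0r ?mul1r// -expr2 sqr_ge0.
Qed.

(** * Clipping as a monotone map *)

Lemma clip_scale (C : R) v : 0 < C -> 0 <= Num.min 1 (C / enorm v).
Proof. by move=> C0; rewrite le_min ler01 divr_ge0 ?enorm_ge0// ltW. Qed.

Lemma clip_scale_enorm (C : R) v : 0 < C ->
  Num.min 1 (C / enorm v) * enorm v = Num.min (enorm v) C.
Proof.
move=> C0; have [->|v0] := eqVneq (enorm v) 0.
  by rewrite mulr0; apply/esym/min_idPl/ltW.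
by rewrite minr_pMl ?enorm_ge0// mul1r divfK.
Qed.

Lemma enorm_clip_le (C : R) v : 0 < C -> enorm (clip C v) <= C.
Proof.
move=> C0; rewrite enormZ ger0_norm ?clip_scale// clip_scale_enorm//.
by rewrite ge_min lexx orbT.
Qed.

Lemma clip_id (C : R) v : 0 < C -> enorm v <= C -> clip C v = v.
Proof.
move=> C0 vC; rewrite /clip; have [/enorm_eq0 ->|v0] := eqVneq (enorm v) 0.
  by rewrite scaler0.
have v1 : 0 < enorm v by rewrite lt_def v0 enorm_ge0.
by rewrite (min_idPl _) ?scale1r// ler_pdivlMr// mul1r.
Qed.

Lemma clipN (C : R) v : clip C (- v) = - clip C v.
Proof. by rewrite /clip enormN scalerN. Qed.

(** By Cauchy-Schwarz the pairing is at least the product of [|v| - |u|] and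
    [min(|v|, C) - min(|u|, C)], two differences that never have opposite signs. *)
Lemma clip_mono (C : R) u v : 0 < C -> 0 <= dot (u - v) (clip C u - clip C v).
Proof.
move=> C0; rewrite /clip !(dotDl, dotDr, dotNl, dotNr, dotZl, dotZr) -!sqr_enorm.
have := clip_scale u C0; have := clip_scale v C0.
have := clip_scale_enorm u C0; have := clip_scale_enorm v C0.
set a := Num.min 1 _; set b := Num.min 1 _; move=> bE aE b0 a0.
have := dot_le_enorm u v; rewrite [dot v u]dotC.
have : 0 <= (a * enorm v - b * enorm u) * (enorm v - enorm u).
  rewrite bE aE.
  have [uv|vu] := leP (enorm v) (enorm u).
    rewrite mulr_le0// subr_le0// le_min !ge_min.
    by rewrite uv lexx orbT.
  rewrite mulr_ge0// subr_ge0 ?(ltW vu)// le_min !ge_min.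
  by rewrite (ltW vu) lexx orbT.
nra.
Qed.

(* Clipping is monotone, so [<v, clip (s v + xi)>] increases with [s]; comparing [s = 1]
   with [s = 0] gives the first bound, and with the [s] for which
   [s * enorm v = hfun C v] the second one: there neither argument is clipped. *)
Lemma dot_clip_ray (C s : R) v xi : 0 < C -> s <= 1 ->
  dot v (clip C (s *: v + xi)) <= dot v (clip C (v + xi)).
Proof.
move=> C0; rewrite le_eqVlt => /predU1P[->|s1]; first by rewrite scale1r.
have := clip_mono (v + xi) (s *: v + xi) C0.
rewrite opprD addrACA subrr addr0 -[X in X - _]scale1r -scalerBl dotZl.
by rewrite pmulr_rge0 ?subr_gt0// dotDr dotNr subr_ge0.
Qed.

Lemma dot_clip_sym_ge0 (C : R) v xi : 0 < C ->
  0 <= dot v (clip C (v + xi)) + dot v (clip C (v - xi)).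
Proof.
move=> C0; have h := @dot_clip_ray C 0 v _ C0 ler01.
apply: le_trans (lerD (h xi) (h (- xi))).
by rewrite !scale0r !add0r clipN dotNr subrr.
Qed.

Lemma dot_clip_sym_ge (C : R) v xi : 0 < C -> enorm xi < 3%:R * C / 4%:R ->
  2 * (hfun C v * enorm v) <= dot v (clip C (v + xi)) + dot v (clip C (v - xi)).
Proof.
move=> C0 xiC; have C4 : 0 < C / 4%:R by rewrite divr_gt0.
set s := Num.min 1 (C / 4%:R / enorm v).
have s0 : 0 <= s by exact: clip_scale.
have sE : s * enorm v = hfun C v by rewrite clip_scale_enorm.
have s1 : s <= 1 by rewrite ge_min lexx.
have sC : enorm (s *: v) <= C / 4%:R.
  by rewrite enormZ ger0_norm// sE ge_min lexx orbT.
have h := @dot_clip_ray C s v _ C0 s1.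
apply: le_trans (lerD (h xi) (h (- xi))).
(* Both arguments have norm at most [C / 4 + 3 C / 4 = C], so clipping fixes them; the terms in [xi]
   cancel and [2 s |v|^2] remains. *)
rewrite !clip_id//.
- rewrite !dotDr !dotZr dotNr -sqr_enorm -sE; lra.
- by have := enormD (s *: v) (- xi); rewrite enormN; lra.
- by have := enormD (s *: v) xi; lra.
Qed.

Lemma hfun_ge0 (C : R) v : 0 < C -> 0 <= hfun C v.
Proof. by move=> C0; rewrite le_min enorm_ge0 divr_ge0// ltW. Qed.

(* With [s] the ratio of the norms of [m.v] and [v], the left side is at most
   [min(s |v|, s C/4) * (s |v|)] and [s <= 1]. *)
Lemma hfun_mask_le (C : R) S v : 0 < C ->
  hfun C v * enorm (hadamard (Defs.mask S) v) ^+ 2 <=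
  hfun C (hadamard (Defs.mask S) v) * enorm (hadamard (Defs.mask S) v) * enorm v.
Proof.
move=> C0; set n := enorm (hadamard _ _).
have n0 : 0 <= n := enorm_ge0 _.
have nv : n <= enorm v := enorm_mask_le _ _.
rewrite expr2 mulrA mulrAC -[leRHS]mulrAC ler_wpM2r// /hfun -/n.
have [_|nC] := leP n (C / 4%:R).
  by rewrite mulrC ler_wpM2l// ge_min lexx.
have C4 : 0 <= C / 4%:R by rewrite divr_ge0// ltW.
by rewrite ler_pM// ?ge_min ?lexx ?orbT// le_min enorm_ge0.
Qed.

(** * Averages over the masks *)

Lemma mask_mean_sum k (f : 'rV[R]_d -> R) : mask_mean k f =
  \sum_(S : {set 'I_d} | #|S| == k) ('C(d, k)%:R)^-1 * f (Defs.mask S).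
Proof. by rewrite /mask_mean mulrC mulr_sumr. Qed.

Lemma mask_mean_le k (f g : 'rV[R]_d -> R) :
  (forall S, f (Defs.mask S) <= g (Defs.mask S)) -> mask_mean k f <= mask_mean k g.
Proof.
by move=> fg; rewrite ler_wpM2r ?invr_ge0// ler_sum.
Qed.

Lemma mask_meanZ k a (f : 'rV[R]_d -> R) :
  mask_mean k (fun m => a * f m) = a * mask_mean k f.
Proof. by rewrite /mask_mean -mulr_sumr mulrA. Qed.

Lemma mask_meanD k (f g : 'rV[R]_d -> R) :
  mask_mean k (fun m => f m + g m) = mask_mean k f + mask_mean k g.
Proof. by rewrite /mask_mean big_split mulrDl. Qed.

Lemma mask_mean_cst k (a : R) : (k <= d)%N -> mask_mean k (fun _ : 'rV[R]_d => a) = a.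
Proof.
move=> kd; rewrite /mask_mean sumr_const -(mulr_natr a).
have -> : #|[pred S : {set 'I_d} | #|S| == k]| = 'C(d, k).
  by rewrite -[in RHS](card_ord d) -card_draws; apply: eq_card => A; rewrite !inE.
by rewrite mulfK// pnatr_eq0 -lt0n bin_gt0.
Qed.

(** Each coordinate survives in ['C(d.-1, k)] of the ['C(d, k)] masks, the fraction [(d - k) / d];
    exchanging the sums over masks and coordinates applies this to every square. *)
Lemma mask_mean_sqr_enorm k u : (k <= d)%N ->
  mask_mean k (fun m => enorm (hadamard m u) ^+ 2) = (1 - k%:R / d%:R) * enorm u ^+ 2.
Proof.
move=> kd; rewrite /mask_mean.
under eq_bigr do rewrite sqr_enorm.
rewrite exchange_big mulr_suml sqr_enorm /dot mulr_sumr; apply: eq_bigr => j _.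
have d0 : (0 < d)%N by apply: leq_ltn_trans (ltn_ord j).
rewrite (eq_bigr (fun S => (j \notin S)%:R * (u ord0 j * u ord0 j))); last first.
  by move=> S _; rewrite !mxE; case: (j \in S); rewrite ?mul0r ?mul1r.
rewrite -mulr_suml -natr_sum mulrAC; congr (_ * _).
have -> : (\sum_(S : {set 'I_d} | #|S| == k) (j \notin S))%N = 'C(d.-1, k).
  rewrite big_mkcond.
  (* The masks that keep [j] are the [k]-subsets of the complement of [j]. *)
  have -> : 'C(d.-1, k) = 'C(#|[set~ j]%SET|, k) by rewrite cardsC1 card_ord.
  rewrite -cards_draws -sum1_card [RHS]big_mkcond; apply: eq_bigr => S _.
  by rewrite !inE finset.subsetC finset.sub1set inE; case: (#|S| == k); case: (j \in S).
have : (d * 'C(d.-1, k) = (d - k) * 'C(d, k))%N.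
  by case: (d) d0 kd => // d' _ kd' /=; rewrite mul_bin_down.
move/(congr1 (fun n => n%:R : R)); rewrite !natrM natrB// => h.
have dn0 : d%:R != 0 :> R by rewrite pnatr_eq0 -lt0n.
have Cn0 : 'C(d, k)%:R != 0 :> R by rewrite pnatr_eq0 -lt0n bin_gt0.
apply: (mulIf Cn0); rewrite divfK//; apply: (mulfI dn0); rewrite h.
by field.
Qed.

End EuclideanGeometry.

(** * Gradients of smooth functions *)

Section GradientCalculus.
Context {R : realType} {d : nat}.
Implicit Types (f : 'rV[R]_d -> R) (u v w : 'rV[R]_d).

Lemma derive_gradient f w v : differentiable f w ->
  'D_v f w = dot (gradient f w) v.
Proof.
move=> df; rewrite [in LHS](row_sum_delta v) deriveE// linear_sum.
by apply: eq_bigr => j _; rewrite linearZ /= mxE deriveE// mulrC.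
Qed.

Lemma is_derive_line f w v (s : R) : differentiable f (w + s *: v) ->
  is_derive s 1 (fun t : R => f (w + t *: v)) (dot (gradient f (w + s *: v)) v).
Proof.
move=> df; rewrite -derive_gradient//.
have E : (fun h : R => h^-1 *: (((fun t : R => f (w + t *: v)) \o shift s) (h *: 1)
            - f (w + s *: v))) =
         (fun h : R => h^-1 *: ((f \o shift (w + s *: v)) (h *: v) - f (w + s *: v))).
  apply/funext => h /=; congr (_ *: (f _ - _)).
  by rewrite [h *: 1]mulr1 scalerDl addrCA.
have dv : derivable f (w + s *: v) v by exact: diff_derivable.
apply: DeriveDef; first by rewrite /derivable E.
by rewrite /derive E.
Qed.

(** Subtract from [f] along the segment its tangent and the quadratic term. By Cauchy-Schwarz and
    the Lipschitz bound, the difference [q] has derivative at most [G s |u|^2 - 2 s b = 0] at [s],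
    so [q 1 <= q 0]. *)
Lemma smooth_descent G f w u : smooth G f ->
  f (w + u) <= f w + dot (gradient f w) u + G / 2 * enorm u ^+ 2.
Proof.
move=> [df Gf].
have [a aE] : exists a, a = dot (gradient f w) u by eexists.
have [b bE] : exists b, b = G / 2 * enorm u ^+ 2 by eexists.
rewrite -aE -bE.
have [q [qE dq]] : exists q : R -> R,
    (forall z, q z = f (w + z *: u) - (a * z + b * (z * z))) /\
    (forall s : R, is_derive s 1 q (dot (gradient f (w + s *: u)) u - (a + 2 * s * b))).
  exists ((fun s : R => f (w + s *: u)) - (a *: id + b *: (id * id))); split => // s.
  have di : is_derive s (1 : R) (id : R -> R) 1 by exact: is_derive_id.
  have d1 := is_derive_line (df (w + s *: u)).
  have d2 := is_deriveD (is_deriveZ a di) (is_deriveZ b (is_deriveM di di)).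
  apply: is_derive_eq (is_deriveB d1 d2) _.
  by congr (_ - _); rewrite /GRing.scale /=; ring.
have : q 1 <= q 0.
  apply: (@ler0_derive1_nincr _ q 0 1) => //.
  - move=> s; rewrite in_itv /= => /andP[s0 s1].
    rewrite derive1E (@derive_val _ _ _ _ _ _ _ (dq s)) subr_le0.
    rewrite -lerBlDl aE -dotNl -dotDl.
    apply: (le_trans (dot_le_enorm _ _)).
    apply: (le_trans (ler_wpM2r (enorm_ge0 _) (Gf _ _))).
    rewrite addrAC subrr add0r enormZ gtr0_norm// bE le_eqVlt; apply/orP; left.
    by apply/eqP; field.
  - apply: continuous_subspaceT => s; apply: differentiable_continuous.
    by apply/derivable1_diffP; case: (dq s).
by rewrite !qE scale0r addr0 scale1r !mulr1 !mulr0 addr0 subr0; lra.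
Qed.

(** A gradient step of length [s] from [w] cannot go below the minimum. The length is left free,
    since different choices serve [G = 0], [G > 0] and a bound uniform in both. *)
Lemma smooth_min_gap G f w wmin (s : R) : smooth G f ->
  (forall v, f wmin <= f v) -> 0 <= s ->
  s * (1 - G * s / 2) * enorm (gradient f w) ^+ 2 <= f w - f wmin.
Proof.
move=> sf fmin s0.
have := le_trans (fmin _) (smooth_descent w (- s *: gradient f w) sf).
rewrite dotZr -sqr_enorm enormZ exprMn normrN real_normK ?num_real//; lra.
Qed.

(* The step [s = 1 / (1 + G)] avoids dividing by [G], which may be [0]. *)
Lemma smooth_sqr_gradient_le G f w wmin : 0 <= G -> smooth G f ->
  (forall v, f wmin <= f v) ->
  enorm (gradient f w) ^+ 2 <= 2 * (1 + G) * (f w - f wmin).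
Proof.
move=> G0 sf fmin; have G1 : 0 < 1 + G by lra.
have := smooth_min_gap w sf fmin (ltW (divr_gt0 ltr01 G1)).
set n2 := enorm _ ^+ 2; have n20 : 0 <= n2 by rewrite sqr_ge0.
have -> : 1 / (1 + G) * (1 - G * (1 / (1 + G)) / 2) = (1 + (1 + G)^-1) / 2 / (1 + G).
  by field; rewrite gt_eqF.
move=> h; rewrite -ler_pdivrMl ?mulr_gt0//; apply: le_trans h.
have i0 : 0 <= (1 + G)^-1 by rewrite invr_ge0 ltW.
rewrite ler_wpM2r// invfM ler_wpM2r//.
lra.
Qed.

(** With [G = 0] the gap is at least [s |grad|^2] for every [s >= 0]. If the gradient were nonzero,
    [s = (gap + 1) / |grad|^2] would give [gap + 1 <= gap]. *)
Lemma smooth0_gradient f w wmin : smooth 0 f -> (forall v, f wmin <= f v) ->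
  gradient f w = 0.
Proof.
move=> sf fmin; apply: enorm_eq0; apply/eqP; rewrite -sqrf_eq0; apply/eqP.
set n2 := enorm _ ^+ 2; apply/eqP; rewrite eq_le sqr_ge0 andbT leNgt; apply/negP => n0.
have g0 : 0 <= f w - f wmin by rewrite subr_ge0.
have := smooth_min_gap w sf fmin (divr_ge0 (addr_ge0 g0 ler01) (ltW n0)).
by rewrite mul0r mul0r subr0 mulr1 -/n2 divfK ?gt_eqF//; lra.
Qed.

Lemma continuous_measurable_rV f : continuous f -> measurable_fun setT f.
Proof.
move=> /continuousP cf; apply: (measurability _ (RGenOpens.measurableE R)).
move=> _ [_ [a [b ->] <-]]; rewrite setTI; apply: sub_sigma_algebra.
exact/cf/interval_open.
Qed.

Lemma measurable_coord (j : 'I_d) :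
  measurable_fun setT (fun u : 'rV[R]_d => u ord0 j).
Proof. by apply: continuous_measurable_rV; exact: coord_continuous. Qed.

(* The gradient is the pointwise limit of difference quotients. *)
Lemma measurable_gradient f (j : 'I_d) : (forall w, differentiable f w) ->
  measurable_fun setT (fun w => gradient f w ord0 j).
Proof.
move=> df; have cf : continuous f by move=> w; exact: differentiable_continuous.
pose h n w : R := n.+1%:R * (f (n.+1%:R^-1 *: delta_mx ord0 j + w) - f w).
apply: (@measurable_fun_cvg _ _ _ _ h) => [n|w _].
  apply: measurable_funM => //; apply: measurable_funB.
    apply: (@continuous_measurable_rV (fun w => f (n.+1%:R^-1 *: delta_mx ord0 j + w))).
    move=> w; apply: (@continuous_comp _ _ _ (fun w => _ + w) f); last exact: cf.
    exact: (cvgD (cvg_cst _) (@cvg_id _ _)).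
  exact: continuous_measurable_rV.
rewrite mxE; have dv : derivable f w (delta_mx ord0 j) by exact: diff_derivable.
have hu : (forall n, @harmonic R n != 0) /\ @harmonic R n @[n --> \oo] --> 0.
  by split=> [n|]; [rewrite /harmonic invr_eq0 pnatr_eq0|exact: cvg_harmonic].
have := iffLR (cvgr_dnbhsP _ 0 _) dv _ hu.
suff -> : (fun n => (harmonic n)^-1 *:
    ((f \o shift w) (harmonic n *: delta_mx ord0 j) - f w)) = h ^~ w by [].
by apply/funext => n; rewrite /h /harmonic /= invrK.
Qed.

End GradientCalculus.

(** * Real-valued integrals: domination, finite sums and independence *)

Section Integrals.
Context {disp : measure_display} {T : measurableType disp} {R : realType}.
Implicit Types (mu : {measure set T -> \bar R}) (f g : T -> R).

Lemma integrable_le mu f g : measurable_fun setT f -> (forall x, `|f x| <= g x) ->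
  mu.-integrable setT (EFin \o g) -> mu.-integrable setT (EFin \o f).
Proof.
move=> mf fg; apply: le_integrable => //; first exact/measurable_EFinP.
by move=> x _; rewrite lee_fin (le_trans (fg x))// ler_norm.
Qed.

Lemma integrable_bounded mu f M : mu setT = 1%E -> measurable_fun setT f ->
  (forall x, `|f x| <= M) -> mu.-integrable setT (EFin \o f).
Proof.
move=> mu1 mf fM; apply: measurable_bounded_integrable => //; first by rewrite mu1 ltry.
by exists M; split=> [|N MN x _ /=]; [exact: num_real|rewrite (le_trans (fM x))// ltW].
Qed.

Lemma integrableD_EFin mu f g : mu.-integrable setT (EFin \o f) ->
  mu.-integrable setT (EFin \o g) ->
  mu.-integrable setT (EFin \o (fun x => f x + g x)).
Proof. by move=> fi gi; exact: (integrableD measurableT fi gi). Qed.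

Lemma integrableB_EFin mu f g : mu.-integrable setT (EFin \o f) ->
  mu.-integrable setT (EFin \o g) ->
  mu.-integrable setT (EFin \o (fun x => f x - g x)).
Proof. by move=> fi gi; exact: (integrableB measurableT fi gi). Qed.

Lemma integrableZ_EFin mu f a : mu.-integrable setT (EFin \o f) ->
  mu.-integrable setT (EFin \o (fun x => a * f x)).
Proof. by move=> fi; exact: (integrableZl measurableT a fi). Qed.

Lemma integrable_sum_EFin mu (I : Type) (s : seq I) (P : pred I) (h : I -> T -> R) :
  (forall i, P i -> mu.-integrable setT (EFin \o h i)) ->
  mu.-integrable setT (EFin \o (fun x => \sum_(i <- s | P i) h i x)).
Proof.
move=> hi; have -> : EFin \o (fun x => \sum_(i <- s | P i) h i x) =
    fun x => (\sum_(i <- s | P i) (EFin \o h i) x)%E.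
  by apply/funext => x /=; rewrite sumEFin.
exact: integrable_sum.
Qed.

Lemma Rintegral_sum mu (I : Type) (s : seq I) (P : pred I) (h : I -> T -> R) :
  (forall i, P i -> mu.-integrable setT (EFin \o h i)) ->
  \int[mu]_x (\sum_(i <- s | P i) h i x) = \sum_(i <- s | P i) \int[mu]_x h i x.
Proof.
move=> hi; elim: s => [|i s IH].
  by rewrite big_nil; under eq_Rintegral do rewrite big_nil; rewrite Rintegral_cst// mul0r.
rewrite big_cons; under eq_Rintegral do rewrite big_cons.
case: ifPn => // Pi; rewrite RintegralD// ?IH//; first exact: hi.
exact: integrable_sum_EFin.
Qed.

Lemma Rintegral_cst1 mu a : mu setT = 1%E -> \int[mu]_x a = a.
Proof. by move=> mu1; rewrite Rintegral_cst// mu1 mulr1. Qed.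

(** Adding the bound makes the integrand nonnegative, which opens the way to results on integrals of
    nonnegative functions. *)
Lemma Rintegral_shift mu f M : mu setT = 1%E -> measurable_fun setT f ->
  (forall x, `|f x| <= M) -> \int[mu]_x f x = \int[mu]_x (f x + M) - M.
Proof.
move=> mu1 mf fM; rewrite RintegralD//.
- by rewrite Rintegral_cst1// addrK.
- exact: integrable_bounded fM.
- by apply: (@integrable_bounded _ (cst M) `|M|).
Qed.

Lemma le_Rintegral_bounded mu f M : mu setT = 1%E -> measurable_fun setT f ->
  (forall x, `|f x| <= M) -> `|\int[mu]_x f x| <= M.
Proof.
move=> mu1 mf fM; have fi := integrable_bounded mu1 mf fM.
apply: le_trans (le_normr_Rintegral measurableT fi) _.
rewrite -[leRHS](Rintegral_cst1 M mu1); apply: le_Rintegral => //.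
- exact: integrable_norm.
- by apply: (@integrable_bounded _ (cst M) `|M|).
Qed.

(** The hypothesis on preimages says that [w] pushes the restriction of [mu] to [E] and the multiple
    [q mu] to the same measure. Change of variables then settles nonnegative functions. *)
Lemma Rintegral_indep {disp' : measure_display} {Y : measurableType disp'} mu
    (w : T -> Y) (E : set T) (q : R) (g : Y -> R) :
  measurable_fun setT w -> measurable E -> 0 <= q -> measurable_fun setT g ->
  mu.-integrable setT (EFin \o (g \o w)) ->
  (forall A, measurable A -> mu (w @^-1` A `&` E) = (mu (w @^-1` A) * q%:E)%E) ->
  \int[mu]_(x in E) g (w x) = q * \int[mu]_x g (w x).
Proof.
move=> mw mE q0 mg gi wE.
have key (h : Y -> \bar R) : measurable_fun setT h -> (forall y, 0 <= h y)%E ->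
    (\int[mu]_(x in E) h (w x) = q%:E * \int[mu]_x h (w x))%E.
  move=> mh h0.
  have mhw : measurable_fun setT (h \o w) by exact: measurableT_comp.
  have -> : (\int[mu]_(x in E) h (w x) = \int[mrestr mu mE]_x h (w x))%E.
    have mEc := measurableC mE.
    have z : (\int[mrestr mu mE]_(x in ~` E) h (w x) = 0)%E.
      apply: null_set_integral => //; first exact: measurable_funTS.
      by rewrite /= /mrestr setICl measure0.
    rewrite -[in RHS](setUv E) ge0_integral_setU ?setUv//; last exact/disj_setPCl.
    rewrite z adde0.
    apply: eq_measure_integral => A mA AE.
    by rewrite /= /mrestr setIidl.
  rewrite -(@ge0_integral_pushforward _ _ _ _ _ w mw (mrestr mu mE) setT h)//.
  pose qn := NngNum q0.
  rewrite (@eq_measure_integral _ _ _ _ (pushforward (mscale qn mu) w)); last first.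
    by move=> A mA _; rewrite /= /pushforward /mrestr /mscale/= wE// muleC.
  by rewrite ge0_integral_pushforward// preimage_setT ge0_integral_mscale// => x _; exact: h0.
rewrite /Rintegral /=.
have mgE : measurable_fun setT (EFin \o g) by exact/measurable_EFinP.
(* The nonnegative case applies to the positive and negative parts of [g]; integrability makes the
   second one finite, so that [q] distributes over the difference. *)
have -> : (\int[mu]_(x in E) (g (w x))%:E = q%:E * \int[mu]_x (g (w x))%:E)%E.
  rewrite integralE [in RHS]integralE muleBr//; last first.
    apply: fin_num_adde_defl; rewrite fin_numN.
    exact: integrable_neg_fin_num.
  have kp := key _ (measurable_funepos mgE) (fun=> funepos_ge0 _ _).
  have kn := key _ (measurable_funeneg mgE) (fun=> funeneg_ge0 _ _).
  have pE : (fun x => (g (w x))%:E)^\+%E = (EFin \o g)^\+%E \o w by rewrite -funepos_comp.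
  have nE : (fun x => (g (w x))%:E)^\-%E = (EFin \o g)^\-%E \o w by rewrite -funeneg_comp.
  by rewrite pE nE; congr (_ - _)%E; [exact: kp|exact: kn].
by rewrite fineM//; exact: integrable_fin_num.
Qed.

End Integrals.

(** * Parameter integrals against probability kernels *)

Section Kernels.
Context {d1 d2 : measure_display} {X : measurableType d1} {Y : measurableType d2}.
Context {R : realType}.

(** Shifting by [M x] reduces to a nonnegative integrand. The bound may depend on the parameter
    because it will be [C] times a gradient norm, which is not uniformly bounded. *)
Lemma measurable_Rintegral_kernel (k : R.-pker X ~> Y) (f : X * Y -> R) (M : X -> R) :
  measurable_fun setT f -> measurable_fun setT M ->
  (forall x y, `|f (x, y)| <= M x) ->
  measurable_fun setT (fun x => \int[k x]_y f (x, y)).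
Proof.
move=> mf mM fM.
have -> : (fun x => \int[k x]_y f (x, y)) = (fun x => \int[k x]_y (f (x, y) + M x) - M x).
  apply/funext => x; apply: Rintegral_shift => //; first exact: prob_kernel.
  exact: measurableT_comp mf (pair1_measurable x).
apply: measurable_funB => //; rewrite /Rintegral.
apply: measurableT_comp => //.
apply: (measurable_fun_integral_sfinite_kernel (fun z : X * Y => (f z + M z.1)%:E)).
  by move=> [x y]; rewrite lee_fin -lerBlDr sub0r; have := fM x y; rewrite ler_norml => /andP[].
apply/measurable_EFinP; apply: measurable_funD => //.
exact: measurableT_comp mM measurable_fst.
Qed.

End Kernels.

(** * Measurability of norms and clipped vectors *)

Section Measurability.
Context {disp : measure_display} {T : measurableType disp} {R : realType} {d : nat}.
Implicit Types (u v : T -> 'rV[R]_d).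
(** Measurability of vector-valued maps is tracked coordinatewise, the form in which sums, dot
    products and norms consume it. *)
Local Notation cmeasurable u :=
  (forall j : 'I_d, measurable_fun setT (fun t => u t ord0 j)).

Lemma measurable_dot u v : cmeasurable u -> cmeasurable v ->
  measurable_fun setT (fun t => dot (u t) (v t)).
Proof.
by move=> mu mv; apply: measurable_sum => j; exact: measurable_funM.
Qed.

Lemma measurable_enorm u : cmeasurable u -> measurable_fun setT (fun t => enorm (u t)).
Proof.
move=> mu; apply: (@measurableT_comp _ _ _ _ _ _ (@Num.sqrt R)); last exact: measurable_dot.
by apply: nondecreasing_measurable => // x y; exact: ler_wsqrtr.
Qed.

Lemma cmeasurableD u v : cmeasurable u -> cmeasurable v ->
  cmeasurable (fun t => u t + v t).
Proof.
move=> mu mv j; under eq_fun do rewrite mxE.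
exact: measurable_funD.
Qed.

Lemma cmeasurable_hadamard m u : cmeasurable u -> cmeasurable (fun t => hadamard m (u t)).
Proof.
move=> mu j; under eq_fun do rewrite mxE.
exact: measurable_funM.
Qed.

Lemma cmeasurable_clip C u : 0 < C -> cmeasurable u -> cmeasurable (fun t => clip C (u t)).
Proof.
move=> C0 mu j.
have mx0 (x : R) : 0 < Num.max x C by rewrite lt_max C0 orbT.
(* Replacing the factor by [C / max(|u|, C)] changes it only at [u = 0], where the product is [0]
   anyway. The new factor is monotone in [|u|], hence measurable; the two signs turn decreasing into
   nondecreasing. *)
have -> : (fun t => clip C (u t) ord0 j) =
    (fun t => - (- (C / Num.max (enorm (u t)) C)) * u t ord0 j).
  apply/funext => t; rewrite opprK mxE.
  have [uC|uC] := leP (enorm (u t)) C; last first.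
    rewrite (min_idPr _)// ler_pdivrMr ?mul1r ?(ltW uC)//; exact: lt_trans uC.
  rewrite divff ?gt_eqF// mul1r.
  have [/enorm_eq0 ->|n0] := eqVneq (enorm (u t)) 0; first by rewrite mxE mulr0.
  by rewrite (min_idPl _) ?mul1r// ler_pdivlMr ?mul1r// lt_def n0 enorm_ge0.
apply: measurable_funM => //; apply: measurableT_comp => //.
apply: (@measurableT_comp _ _ _ _ _ _ (fun x : R => - (C / Num.max x C))).
  apply: nondecreasing_measurable => // x y xy.
  rewrite lerN2 ler_pM2l// lef_pV2 ?posrE//.
  by rewrite ge_max !le_max xy lexx orbT.
exact: measurable_enorm.
Qed.

End Measurability.

(** * Alignment of a fixed vector with its noisy clipped copies *)

Section Alignment.
Context {R : realType} {d : nat}.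
Implicit Types (u v m xi : 'rV[R]_d) (mu : {measure set 'rV[R]_d -> \bar R}).
Implicit Types (S : {set 'I_d}).

Lemma masked_law_setT mu m : mu setT = 1%E -> masked_law mu m setT = 1%E.
Proof. by move=> mu1; rewrite /masked_law /pushforward preimage_setT. Qed.

Lemma Rintegral_masked_law mu m (f : 'rV[R]_d -> R) M : mu setT = 1%E ->
  measurable_fun setT f -> (forall xi, `|f xi| <= M) ->
  \int[masked_law mu m]_xi f xi = \int[mu]_xi f (hadamard m xi).
Proof.
move=> mu1 mf fM; rewrite /Rintegral.
have mfh := measurableT_comp mf (measurable_hadamard m).
have mfE : measurable_fun setT (EFin \o f) by exact/measurable_EFinP.
have fi : mu.-integrable (hadamard m @^-1` setT) ((EFin \o f) \o hadamard m).
  rewrite preimage_setT.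
  exact: (integrable_bounded mu1 mfh (fun xi => fM (hadamard m xi))).
by rewrite (integral_pushforward (measurable_hadamard m) mfE fi) ?preimage_setT.
Qed.

(** The offset [a] lets the induction run: once the first draw is fixed, its term [c * f xi] joins
    the offset of the remaining mean. *)
Lemma iid_mean_sum mu n (f : 'rV[R]_d -> R) (a c M : R) : mu setT = 1%E ->
  measurable_fun setT f -> (forall xi, `|f xi| <= M) ->
  iid_mean mu (fun s : n.-tuple _ => a + c * \sum_(xi <- s) f xi) =
  a + c * (n%:R * \int[mu]_xi f xi).
Proof.
move=> mu1 mf fM; elim: n a => [|n IH] a /=; first by rewrite big_nil mul0r.
have -> : (fun xi => iid_mean mu (fun s : n.-tuple _ =>
     a + c * \sum_(x <- [tuple of xi :: s]) f x)) =
   (fun xi => (a + c * (n%:R * \int[mu]_xi f xi)) + c * f xi).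
  apply/funext => xi; rewrite -addrAC -IH; congr (iid_mean _ _).
  by apply/funext => s; rewrite /= big_cons mulrDr addrA.
have fi := integrable_bounded mu1 mf fM.
rewrite RintegralD ?Rintegral_cst1 ?RintegralZl//.
- by rewrite mulrSr; ring.
- by apply: (@integrable_bounded _ _ _ mu (cst (a + c * (n%:R * \int[mu]_xi f xi))) `|a + c * (n%:R * \int[mu]_xi f xi)|).
- exact: integrableZ_EFin.
Qed.

Lemma normr_dot_clip_le C v u : 0 < C -> `|dot v (clip C u)| <= C * enorm v.
Proof.
move=> C0; rewrite (le_trans (normr_dot_le _ _))// mulrC ler_wpM2r ?enorm_ge0//.
exact: enorm_clip_le.
Qed.

Lemma measurable_dot_clip C m v : 0 < C ->
  measurable_fun setT (fun xi => dot v (clip C (v + hadamard m xi))).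
Proof.
move=> C0; apply: measurable_dot => // j; apply: cmeasurable_clip => // {}j.
apply: cmeasurableD => // {}j; apply: cmeasurable_hadamard => {}j.
exact: measurable_coord.
Qed.

Lemma measurable_enorm_lt (c : R) : measurable [set xi : 'rV[R]_d | enorm xi < c].
Proof.
have := measurable_enorm (@measurable_coord R d).
move=> /(_ measurableT `]-oo, c[%classic).
rewrite setTI; set A := _ @^-1` _ => mA.
rewrite (_ : [set _ | _] = A); first by apply: mA; exact: measurable_itv.
by apply/seteqP; split => xi; rewrite /A /= in_itv.
Qed.

Lemma prob_small_le1 C mu : mu setT = 1%E -> prob_small C mu <= 1.
Proof.
move=> mu1; rewrite /prob_small -[leRHS]/(fine 1) fine_le//.
  rewrite ge0_fin_numE// (@le_lt_trans _ _ (mu setT)) ?mu1 ?ltry//.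
  by rewrite -mu1 le_measure ?inE//; exact: measurable_enorm_lt.
by rewrite -mu1 le_measure ?inE//; exact: measurable_enorm_lt.
Qed.

(* Pairing [xi] with [- xi] reduces the estimate to [dot_clip_sym_ge]. *)
Lemma symmetric_alignment mu C v S : 0 < C -> mu setT = 1%E -> symmetric_law mu ->
  prob_small C mu * (hfun C v * enorm v) <=
  \int[mu]_xi dot v (clip C (v + hadamard (Defs.mask S) xi)).
Proof.
move=> C0 mu1 smu; set m := Defs.mask S.
pose f xi := dot v (clip C (v + hadamard m xi)).
pose A := [set xi : 'rV[R]_d | enorm xi < 3%:R * C / 4%:R].
have mf : measurable_fun setT f by exact: measurable_dot_clip.
have fM xi : `|f xi| <= C * enorm v by exact: normr_dot_clip_le.
have mN : measurable_fun setT (fun xi : 'rV[R]_d => - xi).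
  apply: (@measurability _ _ _ _ setT _ (@open 'rV[R]_d)) => //.
  move=> _ [U oU <-]; rewrite setTI; apply: sub_sigma_algebra.
  have /continuousP : continuous (fun xi : 'rV[R]_d => - xi).
    by move=> xi; apply: (cvgN (@cvg_id _ _)).
  exact.
have mA : measurable A by exact: measurable_enorm_lt.
have mfN : measurable_fun setT (f \o (fun xi => - xi)) by exact: measurableT_comp.
have fi := integrable_bounded mu1 mf fM.
have fNi := integrable_bounded mu1 mfN (fun xi => fM (- xi)).
have fN : \int[mu]_xi f (- xi) = \int[mu]_xi f xi.
  rewrite /Rintegral; congr fine.
  have mfE : measurable_fun setT (EFin \o f) by exact/measurable_EFinP.
  have := integral_pushforward mN mfE (D := setT) _ measurableT.
  rewrite preimage_setT => /(_ mu fNi) <-.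
  by apply: eq_measure_integral => B mB _; exact: smu.
set h := hfun C v * enorm v.
have Ai : mu.-integrable setT (EFin \o (fun xi => 2 * h * \1_A xi)).
  apply: (@integrable_bounded _ _ _ _ _ `|2 * h|) => //.
    exact: measurable_funM.
  move=> xi; rewrite normrM indicE.
  by case: (xi \in A); rewrite ?normr1 ?normr0 ?mulr1 ?mulr0.
(* On [A] the paired sum is at least [2 h]; off [A] it is still nonnegative. *)
have : \int[mu]_xi (2 * h * \1_A xi) <= \int[mu]_xi (f xi + f (- xi)).
  apply: le_Rintegral => //; first exact: integrableD_EFin.
  move=> xi _; rewrite /f hadamardNr indicE.
  have [/set_mem xiA|_] := boolP (xi \in A); last first.
    by rewrite mulr0; exact: dot_clip_sym_ge0.
  rewrite mulr1; apply: dot_clip_sym_ge => //.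
  (* Masking shrinks norms, so smallness of the unmasked [xi] is enough. *)
  exact: le_lt_trans (enorm_mask_le _ _) xiA.
rewrite RintegralD// fN RintegralZl//; last first.
  apply: (@integrable_bounded _ _ _ _ _ 1) => //.
  by move=> xi; rewrite indicE; case: (xi \in A); rewrite ?normr1 ?normr0.
have -> : \int[mu]_xi \1_A xi = prob_small C mu.
  by rewrite /Rintegral integral_indic// setIT.
rewrite -/f; lra.
Qed.

End Alignment.

(** * Expected alignment at a fixed iterate *)

Section Training.
Context {R : realType} {d : nat} {X : finType}.
Variables (loss : 'rV[R]_d -> X -> R) (C : R) (B : nat).
Hypotheses (X0 : (0 < #|X|)%N) (C0 : 0 < C) (B0 : (0 < B)%N).
Hypothesis dloss : forall y v, differentiable (loss ^~ y) v.
Implicit Types (w m v : 'rV[R]_d) (mu : {measure set 'rV[R]_d -> \bar R}).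
Local Notation grad := (true_grad loss).

Lemma sum_enum_val (F : X -> R) : \sum_(y : X) F y = \sum_(i < #|X|) F (enum_val i).
Proof. by rewrite -(big_enum_val F); apply: eq_bigl => y. Qed.

Lemma gradient_objective w : gradient (objective loss) w = grad w.
Proof.
apply/rowP => j; rewrite mxE [RHS]mxE summxE.
have dv y : derivable (loss ^~ y) w (delta_mx ord0 j) by exact: diff_derivable.
have E : objective loss = #|X|%:R^-1 *: (\sum_(i < #|X|) (loss ^~ (enum_val i))).
  apply/funext => v; rewrite fctE /objective; congr (_ * _).
  by rewrite fct_sumE sum_enum_val.
rewrite E deriveZ ?derive_sum//; last exact: derivable_sum.
congr (_ * _); rewrite sum_enum_val.
by apply: eq_bigr => i _; rewrite mxE.
Qed.

(** Pairing with the batch average is an average of [B] terms with the same mean, so the iterated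
    integral collapses to a single draw. Change of variables moves the mask from the law into the
    integrand. *)
Lemma masked_alignmentE m w mu : mu setT = 1%E ->
  masked_alignment loss C B m w mu =
  \int[mu]_xi dot (hadamard m (grad w)) (clip C (hadamard m (grad w) + hadamard m xi)).
Proof.
move=> mu1; rewrite /masked_alignment; set v := hadamard m _.
pose f xi := dot v (clip C (v + xi)).
have mf : measurable_fun setT f.
  apply: measurable_dot => // j; apply: cmeasurable_clip => // {}j.
  by apply: cmeasurableD => // {}j; exact: measurable_coord.
have fM xi : `|f xi| <= C * enorm v by exact: normr_dot_clip_le.
have -> : (fun xis : B.-tuple _ => dot v (ghat C (map_tuple (fun xi => v + xi) xis))) =
   (fun xis => 0 + B%:R^-1 * \sum_(xi <- xis) f xi).
  by apply/funext => xis; rewrite add0r /ghat dotZr /= big_map dot_sumr.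
rewrite (iid_mean_sum B 0 B%:R^-1 (masked_law_setT m mu1) mf fM) add0r mulKf.
  exact: (Rintegral_masked_law m mu1 mf fM).
by rewrite pnatr_eq0 -lt0n.
Qed.

Lemma deviation_law_setT w : deviation_law loss w setT = 1%E.
Proof.
rewrite /deviation_law /= /mscale /= /msum.
rewrite (eq_bigr (fun=> 1%:E)) => [|i _]; last exact: diracT.
by rewrite sumEFin sumr_const card_ord -EFinM mulVf// pnatr_eq0 -lt0n.
Qed.

Lemma Rintegral_deviation_law w (f : 'rV[R]_d -> R) M :
  measurable_fun setT f -> (forall xi, `|f xi| <= M) ->
  \int[deviation_law loss w]_xi f xi =
  #|X|%:R^-1 * \sum_(y : X) f (example_grad loss w y - grad w).
Proof.
move=> mf fM; rewrite (Rintegral_shift (deviation_law_setT w) mf fM).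
have mfM : measurable_fun setT (fun xi => (f xi + M)%:E).
  by apply/measurable_EFinP; exact: measurable_funD.
have fM0 xi : (0 <= (f xi + M)%:E)%E.
  by rewrite lee_fin -lerBlDr sub0r; have := fM xi; rewrite ler_norml => /andP[].
rewrite /Rintegral ge0_integral_mscale// ge0_integral_measure_sum//.
under eq_bigr do rewrite integral_dirac// diracT mul1e.
rewrite sumEFin -EFinM /=.
set s := [seq _ | x : X].
have -> : \sum_(i < #|X|) (f (nth 0 s i) + M) = \sum_(y : X) (f (example_grad loss w y - grad w) + M).
  transitivity (\sum_(xi <- s) (f xi + M)); last by rewrite big_image.
  by rewrite (big_nth 0) big_mkord size_image.
rewrite big_split /= mulrDr sumr_const -[M *+ _]mulr_natl mulKf ?addrK//.
by rewrite pnatr_eq0 -lt0n.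
Qed.

(** Adding a deviation to the true gradient restores the gradient of that example, so the empirical
    law averages over the dataset. *)
Lemma deviation_alignmentE m w :
  masked_alignment loss C B m w (deviation_law loss w) =
  #|X|%:R^-1 * \sum_(y : X)
     dot (hadamard m (grad w)) (clip C (hadamard m (example_grad loss w y))).
Proof.
rewrite masked_alignmentE ?deviation_law_setT//.
have fM xi : `|dot (hadamard m (grad w)) (clip C (hadamard m (grad w) + hadamard m xi))|
   <= C * enorm (hadamard m (grad w)) by exact: normr_dot_clip_le.
rewrite (Rintegral_deviation_law w (measurable_dot_clip _ _ C0) fM).
congr (_ * _); apply: eq_bigr => y _.
by rewrite -hadamardDr addrC subrK.
Qed.

Lemma normr_masked_alignment_le m w mu : mu setT = 1%E ->
  `|masked_alignment loss C B m w mu| <= C * enorm (hadamard m (grad w)).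
Proof.
move=> mu1; rewrite masked_alignmentE//; apply: le_Rintegral_bounded => //.
  exact: measurable_dot_clip.
by move=> xi; exact: normr_dot_clip_le.
Qed.

(** For each mask the symmetric estimate applies to [m.grad]. After multiplication by [|grad|],
    [hfun_mask_le] reduces the average to that of [|m.grad|^2], which supplies the factor
    [1 - k / d]. *)
Lemma mask_mean_alignment_ge k w mu : (k <= d)%N -> mu setT = 1%E -> symmetric_law mu ->
  (1 - k%:R / d%:R) * (prob_small C mu * hfun C (grad w) * enorm (grad w)) <=
  mask_mean k (fun m => masked_alignment loss C B m w mu).
Proof.
move=> kd mu1 smu; set P := prob_small C mu; set g := grad w.
have P0 : 0 <= P by exact: fine_ge0.
apply: (@le_trans _ _ (mask_mean k (fun m =>
    P * (hfun C (hadamard m g) * enorm (hadamard m g))))); last first.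
  by apply: mask_mean_le => S; rewrite masked_alignmentE//; exact: symmetric_alignment.
set q := 1 - _.
have -> : q * (P * hfun C g * enorm g) = P * (q * hfun C g * enorm g) by ring.
rewrite mask_meanZ ler_wpM2l//.
have [n0|n0] := eqVneq (enorm g) 0.
  rewrite n0 !mulr0; apply: divr_ge0 => //; apply: sumr_ge0 => S _.
  by rewrite mulr_ge0 ?enorm_ge0 ?hfun_ge0.
have gn0 : 0 < enorm g by rewrite lt_def n0 enorm_ge0.
rewrite -(ler_pM2r gn0).
have -> : q * hfun C g * enorm g * enorm g = hfun C g * (q * enorm g ^+ 2) by ring.
rewrite -mask_mean_sqr_enorm//.
rewrite -mask_meanZ [leRHS]mulrC -mask_meanZ; apply: mask_mean_le => S.
by rewrite [leRHS]mulrC; exact: hfun_mask_le.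
Qed.

End Training.

(** * Averaging over a fresh mask and example *)

Section FreshDraws.
Context {R : realType} {disp : measure_display} {Omega : measurableType disp}.
Variable P : probability Omega R.

(** The values of the mask and the example cut [Omega] into finitely many cells. On each cell the
    integrand depends on [w] alone, and independence replaces the cell by its weight [q]. *)
Lemma fresh_draw_mean (d : nat) (X : finType) (k : nat) (w : Omega -> 'rV[R]_d)
    (S : Omega -> {set 'I_d}) (x : Omega -> X) (F : 'rV[R]_d -> X -> 'rV[R]_d -> R) :
  fresh_draw P k w S x -> measurable_fun setT w ->
  (forall m y, measurable_fun setT (F m y)) ->
  (forall S0 y, P.-integrable setT (EFin \o (F (Defs.mask S0) y \o w))) ->
  let f om := F (Defs.mask (S om)) (x om) (w om) in
  let g om := mask_mean k (fun m => #|X|%:R^-1 * \sum_(y : X) F m y (w om)) in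
  [/\ P.-integrable setT (EFin \o f), P.-integrable setT (EFin \o g) &
      \int[P]_om f om = \int[P]_om g om].
Proof.
move=> [mS mx wSx] mw mF iF f g.
pose E (p : {set 'I_d} * X) := S @^-1` [set p.1] `&` x @^-1` [set p.2].
pose Fw (p : {set 'I_d} * X) om := F (Defs.mask p.1) p.2 (w om).
pose q (p : {set 'I_d} * X) : R := (#|p.1| == k)%:R / 'C(d, k)%:R * #|X|%:R^-1.
have mE p : measurable (E p) by apply: measurableI; [exact: mS|exact: mx].
have q0 p : 0 <= q p by rewrite !mulr_ge0// invr_ge0.
have fE : f = fun om => \sum_p (Fw p \_ (E p)) om.
  apply/funext => om; rewrite (bigD1 (S om, x om))//= big1 ?addr0.
    by rewrite patchT// inE.
  move=> [S0 x0] neq; rewrite patchC// inE /= => -[/= SE xE].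
  by rewrite SE xE eqxx in neq.
have gE : g = fun om => \sum_p q p * Fw p om.
  apply/funext => om; rewrite /g mask_mean_sum big_mkcond /=.
  rewrite -(pair_bigA _ (fun S0 x0 => q (S0, x0) * Fw (S0, x0) om)) /=.
  apply: eq_bigr => S0 _; rewrite /q /=; case: eqP => _; last first.
    by rewrite big1// => y _; rewrite !mul0r.
  by rewrite mulrA mulr_sumr; apply: eq_bigr => y _; rewrite mul1r.
have iEp p : P.-integrable setT (EFin \o (Fw p \_ (E p))).
  rewrite -restrict_EFin; apply/(integrable_mkcond _ (mE p)).
  by apply: (integrableS measurableT) => //; exact: iF.
have iqp p : P.-integrable setT (EFin \o (fun om => q p * Fw p om)).
  by apply: integrableZ_EFin; exact: iF.
split.
- by rewrite fE; exact: integrable_sum_EFin.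
- by rewrite gE; exact: integrable_sum_EFin.
rewrite fE gE !Rintegral_sum//; apply: eq_bigr => p _.
rewrite -Rintegral_mkcond RintegralZl//; last exact: iF.
apply: (Rintegral_indep mw (mE p) (q0 p) (mF _ _) (iF _ _)) => A mA.
by rewrite /q EFinM muleA -(wSx A p.1 p.2 mA) /E setIA.
Qed.

End FreshDraws.

(** * One step of the iteration and its integrability *)

Section SGD.
Context {R : realType} {d : nat} {X : finType}.
Variables (loss : 'rV[R]_d -> X -> R) (G C gamma r : R) (k B T : nat).
Context {disp : measure_display} {Omega : measurableType disp}.
Variables (P : probability Omega R) (w : nat -> Omega -> 'rV[R]_d).
Variables (S : nat -> Omega -> {set 'I_d}) (x : nat -> Omega -> B.-tuple X).
Variables (ptilde : nat -> R.-pker 'rV[R]_d ~> 'rV[R]_d) (wmin : 'rV[R]_d).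
Hypotheses (d0 : (0 < d)%N) (X0 : (0 < #|X|)%N) (B0 : (0 < B)%N) (C0 : 0 < C).
Hypotheses (gamma0 : 0 < gamma) (G0 : 0 <= G) (r0 : 0 <= r) (r1 : r <= 1) (rk : r * d%:R = k%:R).
Hypothesis dloss : forall y v, differentiable (loss ^~ y) v.
Hypothesis Lsmooth : smooth G (objective loss).
Hypothesis Lmin : forall v, objective loss wmin <= objective loss v.
Hypothesis mw : forall t, (1 <= t <= T.+1)%N -> measurable_fun setT (w t).
Hypothesis iL1 : P.-integrable setT (fun om => (objective loss (w 1%N om))%:E).
Hypothesis wS : forall t, (1 <= t <= T)%N -> forall om,
  w t.+1 om = sgd_step loss C gamma (S t om) (x t om) (w t om).
Hypothesis fresh : forall t, (1 <= t <= T)%N -> forall i : 'I_B,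
  fresh_draw P k (w t) (S t) (fun om => tnth (x t om) i).
Hypothesis psym : forall t, (1 <= t <= T)%N -> forall v, symmetric_law (ptilde t v).

Local Notation L := (objective loss).
Local Notation grad := (true_grad loss).

Let gradE v : gradient L v = grad v.
Proof. exact: gradient_objective. Qed.

Let mgrad j : measurable_fun setT (fun v => grad v ord0 j).
Proof.
under eq_fun do rewrite -gradE.
by apply: measurable_gradient; exact: Lsmooth.1.
Qed.

Let mexample y j : measurable_fun setT (fun v => example_grad loss v y ord0 j).
Proof. exact: measurable_gradient. Qed.

Let mL : measurable_fun setT L.
Proof.
apply: continuous_measurable_rV => v.
by apply: differentiable_continuous; exact: Lsmooth.1.
Qed.

Let kd : (k <= d)%N.
Proof. by rewrite -(ler_nat R) -rk; apply: ler_piMl. Qed.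

Let rE : 1 - k%:R / d%:R = 1 - r.
Proof. by rewrite -rk mulfK// pnatr_eq0 -lt0n. Qed.

Let F m (y : X) v : R :=
  dot (hadamard m (grad v)) (clip C (hadamard m (example_grad loss v y))).

Let a t om := dot (grad (w t om))
  (ghat C (map_tuple (fun y => hadamard (Defs.mask (S t om)) (example_grad loss (w t om) y)) (x t om))).

(** The clipped vectors are already masked, and a mask is idempotent and self-adjoint. The true
    gradient can therefore be masked inside the pairing, as in the bias term. *)
Let aE t om :
  a t om = B%:R^-1 * \sum_(i < B) F (Defs.mask (S t om)) (tnth (x t om) i) (w t om).
Proof.
rewrite /a dotZr /= big_map dot_sumr big_tuple; congr (_ * _).
apply: eq_bigr => i _; rewrite /F -dot_hadamard /clip hadamardZr mask_idem.
by [].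
Qed.

Let FM m y v : `|F m y v| <= C * enorm (hadamard m (grad v)).
Proof. exact: normr_dot_clip_le. Qed.

Let mF m y : measurable_fun setT (F m y).
Proof.
apply: measurable_dot => j; first exact: cmeasurable_hadamard.
apply: cmeasurable_clip => // {}j; exact: cmeasurable_hadamard.
Qed.

Let step t om : (1 <= t <= T)%N ->
  L (w t.+1 om) <= L (w t om) - gamma * a t om + gamma ^+ 2 * (G * C ^+ 2 / 2).
Proof.
move=> tT; rewrite wS// /sgd_step; set g := ghat _ _.
(* An average of vectors of norm at most [C] has norm at most [C]. *)
have gC : enorm g <= C.
  rewrite /g /ghat enormZ ger0_norm ?invr_ge0// ler_pdivrMl ?ltr0n//=.
  apply: (@le_trans _ _ (\sum_(v <- map_tuple (fun y => hadamard (Defs.mask (S t om))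
     (example_grad loss (w t om) y)) (x t om)) C)); last first.
    by rewrite big_tuple sumr_const card_ord mulr_natl.
  elim/big_ind2: _ => [|u a1 v a2 h1 h2|v _]; first by rewrite enorm0.
    exact: le_trans (enormD _ _) (lerD h1 h2).
  exact: enorm_clip_le.
have := smooth_descent (w t om) (- (gamma *: g)) Lsmooth.
rewrite gradE dotNr dotZr enormN enormZ gtr0_norm// exprMn -/(a t om).
move=> /le_trans; apply; rewrite lerD2l mulrCA ler_wpM2l ?sqr_ge0//.
by rewrite mulrAC ler_wpM2r// ler_wpM2l// ler_pXn2r ?nnegrE ?enorm_ge0// ltW.
Qed.

Let inrange t : (1 <= t <= T)%N -> (1 <= t <= T.+1)%N.
Proof. by move=> /andP[-> /leqW]. Qed.

Let mwgrad t j : (1 <= t <= T.+1)%N -> measurable_fun setT (fun om => grad (w t om) ord0 j).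
Proof. by move=> tT; exact: (measurableT_comp (mgrad j) (mw tT)). Qed.

(** The norm satisfies [n <= 1 + n^2], and the squared gradient is bounded by a multiple of the gap
    to the minimum, so an affine function of the objective dominates. *)
Let integrable_enorm t : (1 <= t <= T.+1)%N ->
  P.-integrable setT (EFin \o (fun om => L (w t om))) ->
  P.-integrable setT (EFin \o (fun om => enorm (grad (w t om)))).
Proof.
move=> tT iL.
apply: (@integrable_le _ _ _ P _
  (fun om => (1 - 2 * (1 + G) * L wmin) + 2 * (1 + G) * L (w t om))).
- by apply: measurable_enorm => j; exact: mwgrad.
- move=> om; rewrite ger0_norm ?enorm_ge0//.
  have := smooth_sqr_gradient_le (w t om) G0 Lsmooth Lmin.
  by rewrite gradE; set n := enorm _; have := sqr_ge0 (n - 1); nra.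
- apply: integrableD_EFin; last exact: integrableZ_EFin.
  by apply: (@integrable_bounded _ _ _ P (cst _) `|1 - 2 * (1 + G) * L wmin|) => //; exact: probability_setT.
Qed.

(** By linearity each example of the batch is treated alone, through its joint law with the iterate
    and the mask; all of them contribute the same mean. *)
Let fresh_alignment t : (1 <= t <= T)%N ->
  P.-integrable setT (EFin \o (fun om => L (w t om))) ->
  let g om := mask_mean k (fun m =>
    masked_alignment loss C B m (w t om) (deviation_law loss (w t om))) in
  [/\ P.-integrable setT (EFin \o a t), P.-integrable setT (EFin \o g) &
      \int[P]_om a t om = \int[P]_om g om].
Proof.
move=> tT iL g.
have gE : g = fun om => mask_mean k (fun m => #|X|%:R^-1 * \sum_(y : X) F m y (w t om)).
  apply/funext => om; rewrite /g; congr (mask_mean _ _); apply/funext => m.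
  exact: deviation_alignmentE.
have iF S0 y : P.-integrable setT (EFin \o (F (Defs.mask S0) y \o w t)).
  apply: (@integrable_le _ _ _ P _ (fun om => C * enorm (grad (w t om)))).
  - exact: (measurableT_comp (mF _ y) (mw (inrange tT))).
  - move=> om; apply: le_trans (FM _ _ _) _.
    by rewrite ler_wpM2l ?(ltW C0)//; exact: enorm_mask_le.
  - by apply: integrableZ_EFin; apply: integrable_enorm => //; exact: inrange.
have h i := fresh_draw_mean (fresh tT i) (mw (inrange tT)) mF iF.
have aE' : a t = fun om => B%:R^-1 * \sum_(i < B) F (Defs.mask (S t om)) (tnth (x t om) i) (w t om).
  by apply/funext => om; exact: aE.
have iS : P.-integrable setT (EFin \o (fun om =>
    \sum_(i < B) F (Defs.mask (S t om)) (tnth (x t om) i) (w t om))).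
  by apply: integrable_sum_EFin => i _; case: (h i).
split.
- by rewrite aE'; exact: integrableZ_EFin.
- by rewrite gE; case: (h (Ordinal B0)).
rewrite aE' gE RintegralZl// Rintegral_sum; last by move=> i _; case: (h i).
rewrite (eq_bigr (fun=> \int[P]_om mask_mean k (fun m => #|X|%:R^-1 * \sum_(y : X) F m y (w t om)))); last first.
  by move=> i _; case: (h i).
by rewrite sumr_const card_ord -(mulr_natl (Rintegral _ _ _)) mulKf// pnatr_eq0 -lt0n.
Qed.

(** Integrability propagates along the run: the minimum bounds the next value from below, the
    descent inequality bounds it from above. *)
Let integrable_L t : (1 <= t <= T.+1)%N ->
  P.-integrable setT (EFin \o (fun om => L (w t om))).
Proof.
elim: t => // -[_ _|t IH tT]; first exact: iL1.
have tT' : (1 <= t.+1 <= T)%N by [].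
have iL := IH (inrange tT'); have [ia _ _] := fresh_alignment tT' iL.
set c := gamma ^+ 2 * (G * C ^+ 2 / 2).
(* The descent bound is at least [L wmin]; adding [|L wmin| - L wmin] lifts it to at least
   [|L wmin|], so that it dominates the negative values too. *)
apply: (@integrable_le _ _ _ P _ (fun om => (L (w t.+1 om) + - gamma * a t.+1 om) +
   (c + (`|L wmin| - L wmin)))).
- exact: (measurableT_comp mL (mw tT)).
- move=> om; have := step om tT'; have := Lmin (w t.+2 om); rewrite -/c.
  have := ler_norm (L wmin); have := ler_norm (- L wmin); rewrite normrN => h1 h2 h3 h4.
  by rewrite ler_norml; lra.
- apply: integrableD_EFin; first by apply: integrableD_EFin => //; exact: integrableZ_EFin.
  by apply: (@integrable_bounded _ _ _ P (cst _) `|c + (`|L wmin| - L wmin)|) => //; exact: probability_setT.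
Qed.

(** * Expected descent, telescoping and the surplus of the last step *)

Let D t := \int[P]_om mask_mean k (fun m =>
  masked_alignment loss C B m (w t om) (deviation_law loss (w t om))).

Let EL t := \int[P]_om L (w t om).

Let c2 := gamma ^+ 2 * (G * C ^+ 2 / 2).

Let EL_ge t : (1 <= t <= T.+1)%N -> L wmin <= EL t.
Proof.
move=> tT; rewrite -(Rintegral_cst1 (L wmin) (probability_setT P)).
apply: le_Rintegral => //; last exact: integrable_L.
by apply: (@integrable_bounded _ _ _ P (cst _) `|L wmin|) => //; exact: probability_setT.
Qed.

Let EL_step t : (1 <= t <= T)%N -> EL t.+1 <= EL t - gamma * D t + c2.
Proof.
move=> tT; have iL := integrable_L (inrange tT).
have [ia _ aD] := fresh_alignment tT iL.
rewrite /D -aD -RintegralZl// -RintegralB//; last exact: integrableZ_EFin.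
rewrite -[c2](Rintegral_cst1 _ (probability_setT P)) -RintegralD//.
- apply: le_Rintegral => //.
  + by apply: integrable_L; case/andP: tT.
  + apply: integrableD_EFin.
      by apply: integrableB_EFin => //; exact: integrableZ_EFin.
    by apply: (@integrable_bounded _ _ _ P (cst _) `|c2|) => //; exact: probability_setT.
  + by move=> om _; exact: step.
- by apply: integrableB_EFin => //; exact: integrableZ_EFin.
- by apply: (@integrable_bounded _ _ _ P (cst _) `|c2|) => //; exact: probability_setT.
Qed.

Let EL_telescope n : (n <= T)%N ->
  gamma * (\sum_(1 <= t < n.+1) D t) <= EL 1 - EL n.+1 + n%:R * c2.
Proof.
elim: n => [_|n IH nT]; first by rewrite big_geq// mulr0 subrr mul0r addr0.
rewrite big_nat_recr//= mulrDr mulrS; have := IH (ltnW nT).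
have := @EL_step n.+1; rewrite nT => /(_ isT); lra.
Qed.

(* Before the last step the gap [L (w T) - L wmin] is at least [|grad|^2 / (2 G)], while
   the step gains at most [gamma C |m.grad|]; averaging over the masks leaves a surplus. *)
Let pointwise_surplus v : 0 < G ->
  r / 4 * (gamma ^+ 2 * G * C ^+ 2) <=
  L v - L wmin - gamma * mask_mean k (fun m =>
    masked_alignment loss C B m v (deviation_law loss v)) + c2.
Proof.
move=> Gp; set n := enorm (grad v).
have gap : n ^+ 2 / (2 * G) <= L v - L wmin.
  have Gi : 0 <= G^-1 by rewrite invr_ge0.
  have := smooth_min_gap v Lsmooth Lmin Gi.
  rewrite gradE -/n mulfV ?gt_eqF//; apply: le_trans.
  by rewrite le_eqVlt; apply/orP; left; apply/eqP; field; rewrite gt_eqF.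
(* With [c = G gamma C], the weighted inequality [|m.grad| <= th c / 2 + |m.grad|^2 / (2 th c)] is
   averaged over masks. As [1 - r <= th], the gap absorbs the quadratic part; as [th = 1 - r / 2], a
   share [(1 - th) / 2 = r / 4] of [gamma^2 G C^2] is left over. *)
pose th := 1 - r / 2; have th0 : 0 < th by move: r1; rewrite /th; lra.
have am : mask_mean k (fun m => masked_alignment loss C B m v (deviation_law loss v)) <=
    C * (th / 2 * (G * gamma * C) + (G * gamma * C)^-1 / (2 * th) * ((1 - r) * n ^+ 2)).
  rewrite -[1 - r]rE -mask_mean_sqr_enorm// -mask_meanZ.
  rewrite -[X in X + _](mask_mean_cst _ kd) -mask_meanD -mask_meanZ.
  apply: mask_mean_le => A.
  apply: le_trans (ler_norm _) _.
  apply: le_trans (normr_masked_alignment_le _ _ _ _ _ (deviation_law_setT _ X0 _)) _ => //.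
  rewrite ler_wpM2l ?(ltW C0)//.
  set m := enorm _; set c := G * gamma * C.
  have c0 : 0 < c by rewrite !mulr_gt0.
  rewrite -subr_ge0.
  have -> : th / 2 * c + c^-1 / (2 * th) * m ^+ 2 - m = (th * c - m) ^+ 2 / (2 * th * c).
    by field; rewrite !gt_eqF.
  by rewrite divr_ge0 ?sqr_ge0// !mulr_ge0// ltW.
have GE : gamma * (C * (th / 2 * (G * gamma * C) +
      (G * gamma * C)^-1 / (2 * th) * ((1 - r) * n ^+ 2))) =
    th / 2 * (gamma ^+ 2 * G * C ^+ 2) + (1 - r) / th * (n ^+ 2 / (2 * G)).
  by field; rewrite !gt_eqF.
have := ler_wpM2l (ltW gamma0) am; rewrite GE => {GE}am.
have q1 : (1 - r) / th <= 1 by rewrite ler_pdivrMr// mul1r /th; move: r0; lra.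
have N0 : 0 <= n ^+ 2 / (2 * G) by rewrite divr_ge0 ?sqr_ge0// mulr_ge0.
have := ler_wpM2r N0 q1; rewrite mul1r => qN.
have -> : c2 = (gamma ^+ 2 * G * C ^+ 2) / 2 by rewrite /c2; ring.
move: gap am qN; rewrite /th; lra.
Qed.

Let EL_surplus t : (1 <= t <= T)%N -> 0 < G ->
  r / 4 * (gamma ^+ 2 * G * C ^+ 2) <= EL t - L wmin - gamma * D t + c2.
Proof.
move=> tT Gp; have iL := integrable_L (inrange tT).
have [_ ig _] := fresh_alignment tT iL.
have icst b : P.-integrable setT (EFin \o (fun=> b : R)).
  by apply: (@integrable_bounded _ _ _ P (cst _) `|b|) => //; exact: probability_setT.
have iB1 := integrableD_EFin iL (icst (- L wmin + c2)).
have iB2 := integrableZ_EFin (- gamma) ig.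
have -> : EL t - L wmin - gamma * D t + c2 = \int[P]_om
    ((L (w t om) + (- L wmin + c2)) + - gamma * mask_mean k (fun m =>
      masked_alignment loss C B m (w t om) (deviation_law loss (w t om)))).
  rewrite (RintegralD measurableT iB1 iB2) (RintegralD measurableT iL (icst _)).
  rewrite (RintegralZl (- gamma) measurableT ig) (Rintegral_cst1 _ (probability_setT P)).
  by rewrite /EL /D; ring.
rewrite -[leLHS](Rintegral_cst1 _ (probability_setT P)).
apply: le_Rintegral => //; first exact: integrableD_EFin.
by move=> om _; have := pointwise_surplus (w t om) Gp; lra.
Qed.

(** For [G > 0] telescoping stops before the last step, which is estimated by [EL_surplus] instead.
    Otherwise the full telescope and [EL_ge] suffice, with [delta = 0]. *)
Let last_step_surplus : (0 < T)%N -> exists2 delta : R, 0 <= delta &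
  (0 < r -> 0 < G -> 0 < delta) /\
  gamma * (\sum_(1 <= t < T.+1) D t) <= EL 1 - L wmin + T%:R * c2 - delta.
Proof.
move=> T0; have [Gp|] := ltP 0 G; last first.
  move=> Gn; exists 0 => //; split; first by [].
  have := EL_telescope (leqnn T); have := @EL_ge T.+1; rewrite leqnn => /(_ isT).
  lra.
exists (r / 4 * (gamma ^+ 2 * G * C ^+ 2)).
  by rewrite mulr_ge0 ?divr_ge0// mulr_ge0 ?sqr_ge0// mulr_ge0 ?sqr_ge0.
split=> [rp _|]; first by rewrite mulr_gt0 ?divr_gt0// !mulr_gt0 ?exprn_gt0.
have := EL_telescope (leq_pred T); rewrite prednK//.
have := @EL_surplus T; rewrite T0 leqnn => /(_ isT Gp).
rewrite big_nat_recr//= -[in T%:R * c2](prednK T0) -natr1; lra.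
Qed.

(** * Alignment under the symmetric proxies and the choice of [kappa] *)

Let I t := \int[P]_om (prob_small C (ptilde t (w t om)) *
  hfun C (grad (w t om)) * enorm (grad (w t om))).

Let b t := \int[P]_om mask_mean k (fun m => bias loss C B (ptilde t (w t om)) m (w t om)).

Let pprob t v : ptilde t v setT = 1%E.
Proof. exact: prob_kernel. Qed.

Let I_ge0 t : 0 <= I t.
Proof.
apply: Rintegral_ge0 => om _.
by rewrite !mulr_ge0 ?hfun_ge0 ?enorm_ge0//; exact: fine_ge0.
Qed.

Let measurable_ptilde_alignment t m :
  measurable_fun setT (fun v => masked_alignment loss C B m v (ptilde t v)).
Proof.
pose f (z : 'rV[R]_d * 'rV[R]_d) := dot (hadamard m (grad z.1))
  (clip C (hadamard m (grad z.1) + hadamard m z.2)).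
have -> : (fun v => masked_alignment loss C B m v (ptilde t v)) =
    (fun v => \int[ptilde t v]_xi f (v, xi)).
  by apply/funext => v; rewrite masked_alignmentE.
have m1 j : measurable_fun setT (fun z : 'rV[R]_d * 'rV[R]_d => grad z.1 ord0 j).
  exact: (measurableT_comp (mgrad j) measurable_fst).
have m2 j : measurable_fun setT (fun z : 'rV[R]_d * 'rV[R]_d => z.2 ord0 j).
  exact: (measurableT_comp (measurable_coord j) measurable_snd).
apply: (@measurable_Rintegral_kernel _ _ _ _ _ (ptilde t) f
   (fun v => C * enorm (hadamard m (grad v)))).
- apply: measurable_dot => j; first exact: cmeasurable_hadamard.
  apply: cmeasurable_clip => // {}j; apply: cmeasurableD => {}j;
  exact: cmeasurable_hadamard.
- by apply: measurable_funM => //; apply: measurable_enorm => j; exact: cmeasurable_hadamard.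
- by move=> v xi; exact: normr_dot_clip_le.
Qed.

(** Subtracting the bias exchanges the true law of the deviations for the proxy, whose symmetry
    allows [mask_mean_alignment_ge] at each outcome. *)
Let alignment_ge t : (1 <= t <= T)%N -> (1 - r) * I t <= D t - b t.
Proof.
move=> tT; have tT1 := inrange tT; have iL := integrable_L tT1.
have [_ ig _] := fresh_alignment tT iL; have ien := integrable_enorm tT1 iL.
pose MA om := mask_mean k (fun m => masked_alignment loss C B m (w t om) (ptilde t (w t om))).
have iMA : P.-integrable setT (EFin \o MA).
  have -> : MA = fun om => \sum_(A : {set 'I_d} | #|A| == k) ('C(d, k)%:R)^-1 *
      masked_alignment loss C B (Defs.mask A) (w t om) (ptilde t (w t om)).
    by apply/funext => om; exact: mask_mean_sum.
  apply: integrable_sum_EFin => A _; apply: integrableZ_EFin.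
  apply: (@integrable_le _ _ _ P _ (fun om => C * enorm (grad (w t om)))).
  - exact: (measurableT_comp (measurable_ptilde_alignment t (Defs.mask A)) (mw tT1)).
  - move=> om; apply: le_trans (normr_masked_alignment_le _ _ _ _ _ _) _ => //.
    by rewrite ler_wpM2l ?(ltW C0)//; exact: enorm_mask_le.
  - exact: integrableZ_EFin.
have -> : D t - b t = \int[P]_om MA om.
  have bE : b t = \int[P]_om (mask_mean k (fun m => masked_alignment loss C B m (w t om)
      (deviation_law loss (w t om))) - MA om).
    apply: eq_Rintegral => om _; rewrite /MA -mulN1r -mask_meanZ -mask_meanD.
    by congr (mask_mean _ _); apply/funext => m; rewrite /bias mulN1r.
  by rewrite bE RintegralB// -/(D t) opprB addrCA subrr addr0.
have iI : P.-integrable setT (EFin \o (fun om => prob_small C (ptilde t (w t om)) *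
    hfun C (grad (w t om)) * enorm (grad (w t om)))).
  have mA : measurable [set xi : 'rV[R]_d | enorm xi < 3%:R * C / 4%:R].
    exact: measurable_enorm_lt.
  apply: (@integrable_le _ _ _ P _ (fun om => C / 4%:R * enorm (grad (w t om)))).
  - apply: measurable_funM; last by apply: measurable_enorm => j; exact: mwgrad.
    apply: measurable_funM.
      apply: (@measurableT_comp _ _ _ _ _ _ fine) => //.
      exact: (measurableT_comp (measurable_kernel (ptilde t) _ mA) (mw tT1)).
    apply: measurable_minr => //; apply: measurable_enorm => j; exact: mwgrad.
  - move=> om; rewrite !normrM (ger0_norm (enorm_ge0 _)) ler_wpM2r ?enorm_ge0//.
    rewrite (ger0_norm (hfun_ge0 _ _))// ger0_norm ?fine_ge0//.
    rewrite -[leRHS]mul1r ler_pM ?fine_ge0 ?hfun_ge0//; last by rewrite ge_min lexx orbT.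
    exact: prob_small_le1.
  - exact: integrableZ_EFin.
rewrite /I -RintegralZl//; apply: le_Rintegral => //; first exact: integrableZ_EFin.
move=> om _; rewrite -rE; apply: mask_mean_alignment_ge => //.
exact: psym.
Qed.

Lemma clipped_sgd_bound : (0 < T)%N -> exists kappa : R,
  (if r == 0 then kappa = 1 else 1 - r < kappa < 1) /\
  T%:R^-1 * (\sum_(1 <= t < T.+1) I t) <= kappa^-1 *
    ((EL 1 - L wmin) / (gamma * T%:R) + gamma * (G * C ^+ 2 / 2%:R)
     - T%:R^-1 * \sum_(1 <= t < T.+1) b t).
Proof.
move=> T0; have [delta del0 [delp sumD]] := last_step_surplus T0.
set SI := \sum_(1 <= t < T.+1) I t; set Sb := \sum_(1 <= t < T.+1) b t.
have SI0 : 0 <= SI by apply: sumr_ge0.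
have SD : (1 - r) * SI <= \sum_(1 <= t < T.+1) D t - Sb.
  rewrite mulr_sumr -sumrB; rewrite big_nat_cond [leRHS]big_nat_cond.
  by apply: ler_sum => t /andP[tT _]; exact: alignment_ge.
have SIG : G = 0 -> SI = 0.
  move=> GE; apply: big1 => t _; rewrite /I.
  under eq_Rintegral do rewrite -gradE (smooth0_gradient _ _ Lmin) -?GE// enorm0 mulr0.
  by rewrite Rintegral_cst// mul0r.
set A := _ + _ - _.
(* This is the bound with [kappa = 1 - r] and [delta / gamma] to spare; the spare amount pays for
   raising [kappa]. *)
have TA : (1 - r) * SI + delta / gamma <= T%:R * A.
  have -> : T%:R * A = gamma^-1 * (EL 1 - L wmin + T%:R * c2) - Sb.
    by rewrite /A /c2; field; rewrite gt_eqF// pnatr_eq0 -lt0n T0.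
  have : \sum_(1 <= t < T.+1) D t <= gamma^-1 * (EL 1 - L wmin + T%:R * c2 - delta).
    by rewrite ler_pdivlMl.
  by rewrite mulrBr [gamma^-1 * delta]mulrC; lra.
have Tp : 0 < T%:R :> R by rewrite ltr0n.
suff [kappa [kr kSI]] : exists kappa : R,
    (if r == 0 then kappa = 1 else 1 - r < kappa < 1) /\ kappa * SI <= T%:R * A.
  exists kappa; split=> //.
  have kp : 0 < kappa.
    move: kr; case: eqP => [_ ->//|_ /andP[h _]]; apply: le_lt_trans h; move: r1; lra.
  by rewrite ler_pdivrMl// mulrCA ler_pdivlMl.
have dg0 : 0 <= delta / gamma by rewrite divr_ge0// ltW.
have [re0|rn0] := eqVneq r 0.
  by exists 1; split=> //; move: TA; rewrite re0 subr0; lra.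
have rp : 0 < r by rewrite lt_def rn0.
have [Ge0|Gn0] := eqVneq G 0.
  (* Here all gradients vanish and [SI = 0], so any value strictly between [1 - r] and [1] works. *)
  exists (1 - r / 2); split; first by apply/andP; split; lra.
  by move: TA; rewrite SIG// !mulr0 add0r; lra.
have dp : 0 < delta / gamma by rewrite divr_gt0// delp// lt_def Gn0.
(* The first bound keeps [1 - r + eps] below [1], the second gives [eps * SI <= delta / gamma];
   dividing by [SI + 1] covers [SI = 0]. *)
pose eps := Num.min (r / 2) (delta / gamma / (SI + 1)).
have SI1 : 0 < SI + 1 by lra.
have e0 : 0 < eps by rewrite lt_min (divr_gt0 rp)//= (divr_gt0 dp).
have er : eps <= r / 2 by rewrite ge_min lexx.
have eSI : eps * SI <= delta / gamma.
  apply: (@le_trans _ _ (eps * (SI + 1))).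
    by rewrite ler_wpM2l ?(ltW e0)//; lra.
  by rewrite -ler_pdivlMr// ge_min lexx orbT.
exists (1 - r + eps); split; first by apply/andP; split; lra.
by rewrite mulrDl; lra.
Qed.

End SGD.

Theorem theorem3p7 (R : realType) (d : nat) (X : finType)
    (loss : 'rV[R]_d -> X -> R) (G C gamma r : R) (k B T : nat)
    (disp : measure_display) (Omega : measurableType disp)
    (P : probability Omega R)
    (w : nat -> Omega -> 'rV[R]_d)
    (S : nat -> Omega -> {set 'I_d})
    (x : nat -> Omega -> B.-tuple X)
    (ptilde : nat -> R.-pker 'rV[R]_d ~> 'rV[R]_d)
    (wmin : 'rV[R]_d) :
  (0 < d)%N -> (0 < #|X|)%N -> (0 < B)%N -> (0 < T)%N ->
  0 < C -> 0 < gamma -> 0 <= G ->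
  0 <= r -> r <= 1 -> r * d%:R = k%:R ->
  (forall y v, differentiable (loss ^~ y) v) ->
  smooth G (objective loss) ->
  (forall v, objective loss wmin <= objective loss v) ->
  (forall t, (1 <= t <= T.+1)%N -> measurable_fun setT (w t)) ->
  P.-integrable setT (fun om => (objective loss (w 1%N om))%:E) ->
  (forall t, (1 <= t <= T)%N -> forall om,
     w t.+1 om = sgd_step loss C gamma (S t om) (x t om) (w t om)) ->
  (forall t, (1 <= t <= T)%N -> forall i : 'I_B,
     fresh_draw P k (w t) (S t) (fun om => tnth (x t om) i)) ->
  (forall t, (1 <= t <= T)%N -> forall v, symmetric_law (ptilde t v)) ->
  (forall t, (1 <= t <= T)%N -> forall v,
     Num.sqrt (1 - r) <= prob_small C (ptilde t v)) ->
  exists kappa : R,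
    (if r == 0 then kappa = 1 else 1 - r < kappa < 1) /\
    T%:R^-1 * \sum_(1 <= t < T.+1)
      \int[P]_om (prob_small C (ptilde t (w t om)) *
                  hfun C (true_grad loss (w t om)) *
                  enorm (true_grad loss (w t om)))
    <= kappa^-1 *
       (((\int[P]_om objective loss (w 1%N om)) - objective loss wmin)
          / (gamma * T%:R)
        + gamma * (G * C ^+ 2 / 2%:R)
        - T%:R^-1 * \sum_(1 <= t < T.+1)
            \int[P]_om mask_mean k (fun m =>
              bias loss C B (ptilde t (w t om)) m (w t om))).
Proof.
move=> d0 X0 B0 T0 C0 gamma0 G0 r0 r1 rk dloss Lsmooth Lmin mw iL1 wS fresh psym _.
exact: (clipped_sgd_bound d0 X0 B0 C0 gamma0 G0 r0 r1 rk dloss Lsmooth Lmin mw iL1 wS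
  fresh psym T0).
Qed.
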